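(* For each integer $n\geq 2$ there is a binary relation $\mathbf{C}_n=(C_{n-},C_{n+},C_n)$ with $|C_{n-}|=|C_{n+}|=n!$ such that $\delta(\mathbf{C}_n)=\delta(\mathbf{C}_n^\perp)=n$.
   Context: A binary relation is a triple $\mathbf{A}=(A_-,A_+,A)$ where $A_-,A_+$ are sets and $A\subseteq A_-\times A_+$. A subset $Y\subseteq A_+$ is $\mathbf{A}$-dominating if for every $a\in A_-$ there is $\alpha\in Y$ with $a\mathrel{A}\alpha$. The dominating number $\delta(\mathbf{A})$ is the minimum cardinality of an $\mathbf{A}$-dominating family, and $\delta(\mathbf{A})=\infty$ if no dominating family exists. The dual of $\mathbf{A}$ is $\mathbf{A}^\perp=(A_+,A_-,R)$ where for $x\in A_+$, $y\in A_-$, $x\mathrel{R}y$ holds if and only if $y\mathrel{A}x$ fails. *)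

(* Defs.v *)
From mathcomp Require Import all_boot.
From mathcomp Require Import all_classical.

Set Implicit Arguments.
Unset Strict Implicit.
Unset Printing Implicit Defensive.

Local Open Scope classical_set_scope.
Local Open Scope card_scope.

Record binary_relation : Type := BinaryRelation {
  br_minus : Type;
  br_plus : Type;
  br_rel : br_minus -> br_plus -> Prop
}.

Definition dominating (A : binary_relation) (Y : set (br_plus A)) : Prop :=
  forall a : br_minus A, exists2 alpha, Y alpha & br_rel a alpha.

(* Cardinals are handled relationally: a cardinal is given by any set K having
   it, so [dominating_number A K] reads "delta(A) = |K|", and delta(A) = oo is
   the case where no such K exists. *)
Definition dominating_number (A : binary_relation) (T : Type) (K : set T)
    : Prop :=
  (exists2 Y : set (br_plus A), dominating Y & Y #= K) /\
  (forall Y : set (br_plus A), dominating Y -> K #<= Y).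

Definition dual (A : binary_relation) : binary_relation :=
  {| br_minus := br_plus A;
     br_plus := br_minus A;
     br_rel := fun x y => ~ br_rel y x |}.

Lemma dominating_number_uniq (A : binary_relation) (T U : Type)
    (K : set T) (L : set U) :
  dominating_number A K -> dominating_number A L -> K #= L.
Proof.
move=> [[Y domY YK] minK] [[Z domZ ZL] minL]; rewrite card_eq_le.
by rewrite -(card_le_eqr ZL) -(card_le_eqr YK) minK// minL.
Qed.

(* Main.v *)
Require Import Defs.
From mathcomp Require Import all_boot.
From mathcomp Require Import all_classical.

(** From a relation [R] such that neither [R] nor its dual has a dominating
    family with fewer than [n] elements, build one on index sets [n + 1] times
    larger with [n + 1] in place of [n]: put [(a, i)] in relation with [(b, j)]
    when [R a b] and [i <> j], or when [~ R a b] and [i = j + 1 mod n + 1].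
    Given at most [n] columns [(b_k, j_k)], the [j_k] do not exhaust
    [Z/(n + 1)], so some [j_l - 1] is not among them; a row [a] of [R] that
    evades the at most [n - 1] columns [b_k], [k <> l], then yields the row
    [(a, j_l)] evading all the given columns. The dual is handled in the same
    way.
    Conversely, for a fixed [b] the [n + 1] columns [(b, j)] are dominating, and
    dually for a fixed [a]. *)

Local Open Scope classical_set_scope.
Local Open Scope card_scope.

(** Families are sequences, with repetitions allowed, so that projecting one to a coordinate does
    not change its size. *)
Definition evades {T U : eqType} (n : nat) (R : T -> U -> bool) : Prop :=
  forall s : seq U, (size s < n)%N -> exists a, forall b, b \in s -> ~~ R a b.

Definition corel {T U : Type} (R : T -> U -> bool) : U -> T -> bool :=
  fun b a => ~~ R a b.

Definition extend_rel {T U : Type} {n : nat} (R : T -> U -> bool)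
    : T * 'I_n -> U * 'I_n -> bool :=
  fun x y => if R x.1 y.1 then x.2 != y.2 else x.2 == ordS y.2.

(** A nonempty set of residues closed under predecessor is all of ['I_n], so [s] would have at least
    [n] entries. *)
Lemma ord_pred_notin {n : nat} {s : seq 'I_n} :
  (0 < size s < n)%N -> exists2 i, i \in s & ord_pred i \notin s.
Proof.
case: n s => [|n] s /andP[s_gt0 s_lt]; first by rewrite ltn0 in s_lt.
apply: contrapT => nex.
have closed i : i \in s -> ord_pred i \in s.
  by move=> si; apply: contrapT => /negP nsi; apply: nex; exists i.
case: s s_gt0 s_lt nex closed => // i0 s _ s_lt _ closed.
have down k (i : 'I_n.+1) : i \in i0 :: s -> iter k (@ord_pred _) i \in i0 :: s.
  by move=> si; elim: k => //= k; apply: closed.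
(* Descending at most [i] times never wraps around. The path runs from [i0] down to [ord0], wraps
   once to [ord_max], then descends to any index. *)
have iter0 k (i : 'I_n.+1) : (k <= i)%N ->
    val (iter k (@ord_pred _) i) = (i - k)%N.
  elim: k => [|k IHk] ki /=; first by rewrite subn0.
  rewrite IHk ?(ltnW ki)//; case ik: (i - k)%N => [|p].
    by move: ki; rewrite -subn_gt0 ik.
  rewrite addSn modnDr subnS ik modn_small// -ltnS -ik.
  exact: leq_ltn_trans (leq_subr _ _) (leqW (ltn_ord i)).
have s0 : ord0 \in i0 :: s.
  have <- : iter i0 (@ord_pred _) i0 = ord0.
    by apply: val_inj; rewrite iter0// subnn.
  exact/down/mem_head.
have smax : ord_max \in i0 :: s.
  suff <- : ord_pred (ord0 : 'I_n.+1) = ord_max by exact: closed.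
  by apply: val_inj; rewrite /= modn_small.
have sT (i : 'I_n.+1) : i \in i0 :: s.
  have <- : iter (n - i) (@ord_pred _) ord_max = i.
    by apply: val_inj; rewrite iter0 ?leq_subr//= subKn// -ltnS.
  exact: down.
have := card_size (i0 :: s); rewrite (eq_card (B := predT)) ?card_ord//.
by rewrite leqNgt s_lt.
Qed.

Lemma evades_extend {T U : eqType} {n : nat} {R : T -> U -> bool} :
  (0 < n)%N -> evades n R -> evades n.+1 (extend_rel (n := n.+1) R).
Proof.
move=> n_gt0 evR s s_lt; have [s0|s_gt0] := posnP (size s).
  have [a _] := evR [::] n_gt0; exists (a, ord0) => y.
  by rewrite (size0nil s0).
have /ord_pred_notin[_ /mapP[[b0 j0] sy0 ->] /= nj0] :
    (0 < size (map snd s) < n.+1)%N by rewrite size_map s_gt0.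
have [|a evade_a] := evR (map fst (rem (b0, j0) s)).
  by rewrite size_map size_rem// -ltnS prednK.
exists (a, j0) => -[b j] sbj; rewrite /extend_rel /=.
have j0j : (j0 == ordS j) = false.
  apply: contraNF nj0 => /eqP ->; rewrite ordSK.
  by apply/mapP; exists (b, j).
(* The column set aside is evaded whether or not [R a b0] holds: the indices are equal, and [j0] is
   not its own successor by [j0j]. *)
rewrite j0j; case: (eqVneq (b, j) (b0, j0)) => [[_ ->]|ne].
  by rewrite eqxx; case: ifP.
rewrite ifN//; apply: evade_a; apply/mapP; exists (b, j) => //.
by have := perm_to_rem sy0 => /perm_mem/(_ (b, j)); rewrite sbj inE (negbTE ne).
Qed.

Lemma evades_corel_extend {T U : eqType} {n : nat} {R : T -> U -> bool} :
  (0 < n)%N -> evades n (corel R) ->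
  evades n.+1 (corel (extend_rel (n := n.+1) R)).
Proof.
move=> n_gt0 evR s s_lt; have [s0|s_gt0] := posnP (size s).
  have [b _] := evR [::] n_gt0; exists (b, ord0) => x.
  by rewrite (size0nil s0).
have /ord_pred_notin[_ /mapP[[a0 i0] sx0 ->] /= ni0] :
    (0 < size (map snd s) < n.+1)%N by rewrite size_map s_gt0.
have [|b evade_b] := evR (map fst (rem (a0, i0) s)).
  by rewrite size_map size_rem// -ltnS prednK.
(* The new index is absent from the rows and has successor [i0], so the row set aside is related to
   this column whatever [R a0 b] is. *)
exists (b, ord_pred i0) => -[a i] sai.
rewrite /corel /extend_rel /= negbK ord_predK.
have ii0 : i != ord_pred i0.
  by apply: contraNneq ni0 => <-; apply/mapP; exists (a, i).
rewrite ii0; case: (eqVneq (a, i) (a0, i0)) => [[_ ->]|ne].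
  by rewrite eqxx; case: ifP.
rewrite ifT//; rewrite -[R a b]negbK; apply: evade_b.
apply/mapP; exists (a, i) => //.
by have := perm_to_rem sx0 => /perm_mem/(_ (a, i)); rewrite sai inE (negbTE ne).
Qed.

Lemma evades_rel_exists (n : nat) : exists (T U : finType) (R : T -> U -> bool),
  [/\ #|T| = n.+1`!, #|U| = n.+1`!, evades n.+1 R & evades n.+1 (corel R)].
Proof.
elim: n => [|n [T [U [R [cT cU evR evcR]]]]].
  (* For [1] only the empty family must be evaded, so a single point on each side suffices. *)
  by exists unit, unit, (fun _ _ => true); split;
    rewrite ?card_unit// => -[|//] _; exists tt.
exists (T * 'I_n.+2)%type, (U * 'I_n.+2)%type, (extend_rel R); split.
- by rewrite card_prod card_ord cT mulnC.
- by rewrite card_prod card_ord cU mulnC.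
- exact: evades_extend.
- exact: evades_corel_extend.
Qed.

Definition of_rel {T U : Type} (R : T -> U -> bool) : binary_relation :=
  {| br_minus := T; br_plus := U; br_rel := fun a b => R a b |}.

Lemma dual_of_rel {T U : Type} (R : T -> U -> bool) :
  dual (of_rel R) = of_rel (corel R).
Proof.
rewrite /dual /of_rel /=; congr BinaryRelation.
by apply/funext => b; apply/funext => a; apply/propext; split => /negP.
Qed.

Lemma II_card_le {T : finType} {A : {pred T}} {n : nat} :
  (n <= #|A|)%N -> `I_n #<= [set` A].
Proof.
(* Only a positive [n] guarantees an element of [T] to serve as default for [nth]. *)
case: n => [|n] nA; first by rewrite II0 card_ge0.
have x0 : T by have /card_gt0P/cid[] := leq_trans (ltn0Sn n) nA.
have e_inj : {in `I_n.+1 &, injective (nth x0 (enum A))}.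
  move=> i j; rewrite !inE /= => ni nj /eqP.
  rewrite nth_uniq ?enum_uniq -?cardE ?(leq_trans ni)//.
    by move/eqP.
  exact: leq_trans nj nA.
rewrite -(card_le_eql (inj_card_eq e_inj)); apply: subset_card_le =>
  _ [i /= ni <-].
by rewrite -mem_enum mem_nth// -cardE (leq_trans ni).
Qed.

Lemma card_setT_finType (T : finType) : [set: T] #= `I_#|T|.
Proof.
apply/card_eqPle; split.
  have r_inj : {in [set: T] &, injective (fun x => enum_rank x : nat)}.
    by move=> x y _ _ /val_inj/enum_rank_inj.
  rewrite -(card_le_eql (inj_card_eq r_inj)); apply: subset_card_le =>
    _ [x _ <-].
  exact: ltn_ord.
apply: card_le_trans (II_card_le (A := T) (leqnn _)) _.
exact: subset_card_le.
Qed.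

Lemma evades_dominating {T U : finType} {n : nat} {R : T -> U -> bool}
    (Y : set (br_plus (of_rel R))) :
  evades n R -> dominating Y -> `I_n #<= Y.
Proof.
move=> evR domY.
have YE : [set` [pred b : U | `[< Y b >]]] = Y.
  by apply/seteqP; split => b /=; rewrite inE.
rewrite -YE; apply: II_card_le; rewrite leqNgt; apply/negP => Y_lt.
have [|a evade_a] := evR (enum [pred b : U | `[< Y b >]]).
  by rewrite -cardE.
have [b Yb aRb] := domY a; have := evade_a b.
by rewrite mem_enum inE aRb => /(_ Yb).
Qed.

Lemma dominating_number_ord {T U : finType} {n : nat} {R : T -> U -> bool}
    (f : 'I_n -> U) :
  injective f -> (forall a, exists j, R a (f j)) -> evades n R ->
  dominating_number (of_rel R) `I_n.
Proof.
move=> f_inj f_dom evR; split; last by move=> Y; exact: evades_dominating.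
exists (range f).
  by move=> a; have [j aRj] := f_dom a; exists (f j) => //; exists j.
have f_inj' : {in [set: 'I_n] &, injective f} by move=> i j _ _; apply: f_inj.
apply: card_eq_trans (inj_card_eq f_inj') _.
by rewrite -[n in `I_n]card_ord; exact: card_setT_finType.
Qed.

Lemma ord_neq_exists {n : nat} (i : 'I_n.+2) : exists j, i != j.
Proof.
by have [->|i0] := eqVneq i ord0; [exists ord_max | exists ord0].
Qed.

Theorem theorem6p1 (n : nat) (hn : (2 <= n)%N) :
  exists C : binary_relation,
    [/\ [set: br_minus C] #= `I_(n`!)%N,
        [set: br_plus C] #= `I_(n`!)%N,
        dominating_number C `I_n
      & dominating_number (dual C) `I_n].
Proof.
case: n hn => [|[|n]]// _.
(* The last extension is made explicit here, since its form provides the dominating families;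
   evading the empty family gives their base points. *)
have [T [U [R [cT cU evR evcR]]]] := evades_rel_exists n.
have [a0 _] := evR [::] isT; have [b0 _] := evcR [::] isT.
exists (of_rel (extend_rel (n := n.+2) R)); split.
- have := card_setT_finType (T * 'I_n.+2)%type.
  by rewrite card_prod card_ord cT mulnC.
- have := card_setT_finType (U * 'I_n.+2)%type.
  by rewrite card_prod card_ord cU mulnC.
(* The row [(a, i)] is dominated by any [j] other than [i] if [R a b0], and by the predecessor of
   [i] otherwise. *)
- apply: (dominating_number_ord (fun j => (b0, j))); first by move=> i j [].
    move=> [a i]; rewrite /extend_rel /=; case: (R a b0).
      exact: ord_neq_exists.
    by exists (ord_pred i); rewrite ord_predK.
  exact: evades_extend.
- rewrite dual_of_rel.
  apply: (dominating_number_ord (fun i => (a0, i))); first by move=> i j [].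
    move=> [b j]; rewrite /corel /extend_rel /=; case: (R a0 b).
      by exists j; rewrite negbK.
    by have [i ji] := ord_neq_exists (ordS j); exists i; rewrite eq_sym.
  exact: evades_corel_extend.
Qed.
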